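(* For every real $0\leq\alpha\leq 1$ there exists an immeasurable subset of $\mathbb{R}$ of packing dimension $\alpha$. Moreover, these sets can be chosen to be additive subgroups of $\mathbb{R}$.
   Context: Packing dimension is the usual (upper) packing dimension $\dim_p$ of subsets of $\mathbb{R}$. A Borel measure on $\mathbb{R}$ is a (countably additive, $[0,\infty]$-valued) measure $\mu$ defined on a $\sigma$-algebra $\mathcal{S}$ of subsets of $\mathbb{R}$ containing all Borel sets ($\mathcal S$ may be larger than the Borel $\sigma$-algebra, and $\mu$ is not assumed to be $\sigma$-finite on $\mathbb{R}$). It is translation invariant if $S+t\in\mathcal{S}$ and $\mu(S+t)=\mu(S)$ for all $S\in\mathcal{S}$, $t\in\mathbb{R}$. A Borel set $B$ is $\sigma$-finite for $\mu$ if it is a countable union of sets in $\mathcal{S}$ of finite $\mu$-measure. A nonempty Borel set $B\subset\mathbb{R}$ is called immeasurable if for every translation invariant Borel measure $\mu$ on $\mathbb{R}$, either $\mu(B)=0$ or $B$ is not $\sigma$-finite for $\mu$. *)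

(* Defs.v *)
From HB Require Import structures.
From mathcomp Require Import all_boot all_order all_algebra.
From mathcomp Require Import all_classical all_reals all_analysis.

Set Implicit Arguments.
Unset Strict Implicit.
Unset Printing Implicit Defensive.

Import Order.TTheory GRing.Theory Num.Theory.
Import numFieldNormedType.Exports.

Local Open Scope classical_set_scope.
Local Open Scope ring_scope.

(* The least number of closed balls of radius e that cover A (+oo if there is
   no finite cover). *)
Definition covering_number (R : realType) (A : set R) (e : R) : \bar R :=
  ereal_inf [set (size s)%:R%:E | s in
    [set s : seq R | A `<=` \bigcup_(x in [set` s]) closed_ball x e]].

(* Upper Minkowski (box-counting) dimension of a bounded set. Restricting to
   0 <= s only matters for A = set0, whose dimension is then 0. *)
Definition upper_minkowski_dim (R : realType) (A : set R) : \bar R :=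
  ereal_inf [set s%:E | s in [set s : R | 0 <= s /\
    limf_esup (fun e : R => covering_number A e * (e `^ s)%:E)%E 0^'+ = 0%E]].

(* Upper packing dimension:
   inf { sup_i upper_minkowski_dim (F i) : A = \bigcup_i F i, F i bounded }. *)
Definition packing_dim (R : realType) (A : set R) : \bar R :=
  ereal_inf [set ereal_sup (range (fun i => upper_minkowski_dim (F i))) | F in
    [set F : nat -> set R |
      A = \bigcup_i F i /\ forall i, bounded_set (F i)]].

Definition translation_invariant (R : realType) (S : set (set R))
    (mu : set R -> \bar R) : Prop :=
  forall (A : set R) (t : R), S A ->
    S [set x + t | x in A] /\ mu [set x + t | x in A] = mu A.

(* The domain S of mu may be larger than the Borel sigma-algebra (the default
   measurable on R). The measurable sets of g_sigma_algebraType S are those of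
   <<s S >>, which is S itself since S is a sigma-algebra; sigma_finite B mu
   refers to that sigma-algebra, not to the Borel one. *)
Definition immeasurable (R : realType) (B : set R) : Prop :=
  [/\ B !=set0, measurable B &
    forall (S : set (set R))
      (mu : {measure set (g_sigma_algebraType S) -> \bar R}),
      sigma_algebra setT S -> (measurable : set (set R)) `<=` S ->
      translation_invariant S mu ->
      mu B = 0%E \/ ~ @sigma_finite _ (g_sigma_algebraType S) R B mu].

(* Main.v *)
Require Import Defs.
From HB Require Import structures.
From mathcomp Require Import all_boot all_order all_algebra.
From mathcomp Require Import all_classical all_reals all_analysis.
From mathcomp Require Import measurable_realfun ring lra zify.
Import Order.TTheory GRing.Theory Num.Theory.
Import numFieldNormedType.Exports.
Local Open Scope classical_set_scope.
Local Open Scope ring_scope.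

(** Fix the fast growing integers [Q_k = \prod_(j < k) r_j], [r_j = 2^(j+4)],
and weights [h_j = r_j^(alpha + o(1))] tending to infinity with [3 h_j <= r_j].
The group [B] consists of the [x] such that
[r_j * dist (Q_j x, Z) / h_j] tends to [0].

Dimension: up to bounded factors, the constraint leaves about [h_j] choices for
the [j]-th mixed radix digit of [x], so the number of cylinders at scale
[1 / Q_k] is [Q_k^(alpha + o(1))] while [r_k = Q_k^(o(1))]. This bounds the box
dimensions of countably many pieces from above; the lower bound is a Baire
category argument, in which nested cylinders avoid successively the pieces of a
decomposition.

Immeasurability: if [B] is sigma-finite and not null, it contains a set of
finite positive measure, and by Egorov's theorem a set [K] of positive measure
on which the convergence is uniform. Convergence along digit sequences can be
made slower than this uniform rate, which gives a Cantor family of points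
[b] of [B] whose translates [K + b] are pairwise disjoint subsets of [B] of the
same positive measure. An uncountable such family contradicts sigma-finiteness. *)

(** * The group *)

(** Rounding by [Num.floor (y + 2^-1)] names the nearest integer explicitly, so that it can be
    counted later; Borel measurability then follows from the monotonicity of the floor. *)
Definition dist_int {R : realType} (y : R) : R :=
  `| y - (Num.floor (y + 2^-1))%:~R |.

Lemma dist_int_ge0 (R : realType) (y : R) : 0 <= dist_int y.
Proof. exact: normr_ge0. Qed.

Lemma dist_int_le_half (R : realType) (y : R) : dist_int y <= 2^-1.
Proof.
have := floor_itv (y + 2^-1); rewrite intrD => /andP[h1 h2].
by rewrite /dist_int ler_norml; apply/andP; split; lra.
Qed.

Lemma dist_int_le (R : realType) (y : R) (n : int) : dist_int y <= `|y - n%:~R|.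
Proof.
have [<-|nm] := eqVneq (Num.floor (y + 2^-1)) n; first exact: lexx.
apply: le_trans (dist_int_le_half R y) _.
have := floor_itv (y + 2^-1); rewrite intrD => /andP[h1 h2].
rewrite ler_normr; apply/orP.
move: nm h1 h2; set m := Num.floor _ => nm h1 h2.
have [h|h|h] := ltgtP m n; last by rewrite h eqxx in nm.
- right; have : m%:~R + 1 <= n%:~R :> R by rewrite -(intrD _ m 1) ler_int; lia.
  lra.
- left; have : n%:~R + 1 <= m%:~R :> R by rewrite -(intrD _ n 1) ler_int; lia.
  lra.
Qed.

Lemma dist_intB (R : realType) (x y : R) :
  dist_int (x - y) <= dist_int x + dist_int y.
Proof.
pose m := Num.floor (x + 2^-1); pose n := Num.floor (y + 2^-1).
apply: le_trans (dist_int_le R _ (m - n)) _.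
rewrite intrB [X in `|X|](_ : _ = (x - m%:~R) - (y - n%:~R)); last by ring.
exact: ler_normB.
Qed.

Lemma dist_int_small (R : realType) (y : R) : `|y| < 2^-1 -> dist_int y = `|y|.
Proof.
rewrite ltr_norml => /andP[h1 h2]; rewrite /dist_int.
suff -> : Num.floor (y + 2^-1) = 0 by rewrite subr0.
by apply: floor_def; rewrite add0r; apply/andP; split; lra.
Qed.

Lemma measurable_dist_int (R : realType) :
  measurable_fun [set: R] (@dist_int R).
Proof.
apply: measurableT_comp => //; apply: measurable_funB => //.
apply: nondecreasing_measurable => // x y xy.
by rewrite ler_int; apply: le_floor; rewrite lerD2r.
Qed.

(** The exponent is linear in [j], so the exponent of [scale k] is quadratic in [k] and [scale k]
    outgrows every power of [radix k]. The shift by 4 gives [16 * j.+1 <= radix j] from [j = 0]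
    on. *)
Definition radix (j : nat) : nat := (2 ^ (j + 4))%N.

Definition scale (k : nat) : nat := (\prod_(j < k) radix j)%N.

(** The term [j.+1] makes the weights unbounded even for [alpha = 0]. The divisor [j + 4], the
    binary logarithm of [radix j], keeps them below a third of the radix even for [alpha = 1] and
    does not change the growth exponent. *)
Definition gap {R : realType} (alpha : R) (j : nat) : R :=
  j.+1%:R + (radix j)%:R `^ alpha / (j + 4)%:R.

Definition defect {R : realType} (alpha : R) (j : nat) (x : R) : R :=
  (radix j)%:R * dist_int ((scale j)%:R * x) / gap alpha j.

Definition thin_group {R : realType} (alpha : R) : set R :=
  [set x | defect alpha ^~ x @ \oo --> (0 : R)].

Lemma radix_gt0 j : (0 < radix j)%N.
Proof. by rewrite expn_gt0. Qed.

Lemma scale_gt0 k : (0 < scale k)%N.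
Proof. by apply: prodn_gt0 => j; exact: radix_gt0. Qed.

Lemma scaleS k : scale k.+1 = (scale k * radix k)%N.
Proof. by rewrite /scale big_ord_recr. Qed.

Lemma leq_scale j k : (j <= k)%N -> (scale j <= scale k)%N.
Proof.
move=> /subnKC <-; elim: (k - j)%N => [|n IH]; first by rewrite addn0.
by rewrite addnS [leqRHS]scaleS (leq_trans IH) // leq_pmulr // radix_gt0.
Qed.

Section Defect.
Context {R : realType} (alpha : R).

Lemma ge_gap j : j.+1%:R <= gap alpha j.
Proof. by rewrite lerDl divr_ge0 // powR_ge0. Qed.

Lemma gap_ge1 j : 1 <= gap alpha j.
Proof. by apply: le_trans (ge_gap j); rewrite ler1n. Qed.

Lemma gap_gt0 j : 0 < gap alpha j.
Proof. exact: lt_le_trans ltr01 (gap_ge1 j). Qed.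

Lemma defect_ge0 j x : 0 <= defect alpha j x.
Proof. by rewrite divr_ge0 ?mulr_ge0 ?dist_int_ge0 // ltW // gap_gt0. Qed.

Lemma defect_le_radix j x : defect alpha j x <= (radix j)%:R.
Proof.
rewrite ler_pdivrMr ?gap_gt0 // ler_pM ?dist_int_ge0 //.
by apply: le_trans (dist_int_le_half _ _) (le_trans _ (gap_ge1 j)); lra.
Qed.

Lemma defectB j x y :
  defect alpha j (x - y) <= defect alpha j x + defect alpha j y.
Proof.
rewrite -mulrDl -mulrDr ler_pM2r ?invr_gt0 ?gap_gt0 // ler_wpM2l // mulrBr.
exact: dist_intB.
Qed.

Lemma measurable_defect j : measurable_fun [set: R] (defect alpha j).
Proof.
apply: measurable_funM => //; apply: measurable_funM => //.
apply: measurableT_comp; first exact: measurable_dist_int.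
exact: measurable_funM.
Qed.

Lemma thin_groupP x : thin_group alpha x <->
  forall e, 0 < e -> exists N, forall j, (N <= j)%N -> defect alpha j x <= e.
Proof.
split=> [/cvgrPdist_le h e e0|h].
  have [N _ hN] := h e e0; exists N => j Nj; have := hN j Nj.
  by rewrite sub0r normrN ger0_norm ?defect_ge0.
apply/cvgrPdist_le => e e0; have [N hN] := h e e0; exists N => // j Nj.
by rewrite /= sub0r normrN ger0_norm ?defect_ge0 ?hN.
Qed.

Lemma thin_group0 : thin_group alpha 0.
Proof.
apply/thin_groupP => e e0; exists 0%N => j _.
by rewrite /defect mulr0 dist_int_small ?normr0 ?mulr0 ?mul0r ?ltW // invr_gt0.
Qed.

Lemma thin_groupB x y :
  thin_group alpha x -> thin_group alpha y -> thin_group alpha (x - y).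
Proof.
move=> /thin_groupP hx /thin_groupP hy; apply/thin_groupP => e e0.
have e20 : 0 < e / 2 by rewrite divr_gt0.
have [N hN] := hx _ e20; have [M hM] := hy _ e20.
exists (maxn N M) => j; rewrite geq_max => /andP[Nj Mj].
by apply: le_trans (defectB _ _ _) _; rewrite [e]splitr lerD ?hN ?hM.
Qed.

Lemma thin_groupD x y :
  thin_group alpha x -> thin_group alpha y -> thin_group alpha (x + y).
Proof.
move=> hx hy; rewrite -[y]opprK; apply: thin_groupB => //.
by rewrite -sub0r; apply: thin_groupB => //; exact: thin_group0.
Qed.

Lemma measurable_thin_group : measurable (thin_group alpha).
Proof.
have -> : thin_group alpha = \bigcap_p \bigcup_N \bigcap_(j in [set j | (N <= j)%N])
    [set x | defect alpha j x <= p.+1%:R^-1].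
  apply/seteqP; split=> x.
    move=> /thin_groupP h p _; have [|N hN] := h p.+1%:R^-1; first by [].
    by exists N.
  move=> h; apply/thin_groupP => e e0.
  have [p pe] : exists p : nat, p.+1%:R^-1 <= e.
    exists (Num.truncn e^-1); rewrite -[leRHS]invrK lef_pV2 ?posrE ?invr_gt0 //.
    exact/ltW/truncnS_gt.
  have [N _ hN] := h p I; exists N => j Nj; exact: le_trans (hN j Nj) pe.
apply: bigcap_measurable => // p _; apply: bigcup_measurable => N _.
apply: bigcap_measurable; first by exists N => /=.
move=> j _.
rewrite [X in measurable X](_ : _ = setT `&` defect alpha j @^-1` `]-oo, p.+1%:R^-1]).
  exact: measurable_defect.
by rewrite setTI; apply/seteqP; split=> x /=; rewrite in_itv.
Qed.

End Defect.

(** * Mixed radix expansions *)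

(** Digits this small never cause carries: the tail after [k] digits stays below half a unit of
    level [k]. *)
Definition sparse (a : nat -> nat) : Prop := forall j, (3 * a j <= radix j)%N.

(** Divided by [scale k], this is the partial sum of the terms [a j / scale j.+1] over [j < k]. *)
Fixpoint numerator (a : nat -> nat) (k : nat) : nat :=
  if k is j.+1 then (radix j * numerator a j + a j)%N else 0%N.

Definition expansion {R : realType} (a : nat -> nat) : R :=
  sup (range (fun k => (numerator a k)%:R / (scale k)%:R)).

Lemma eq_numerator a b k :
  (forall i, (i < k)%N -> a i = b i) -> numerator a k = numerator b k.
Proof.
by elim: k => //= k IH h; rewrite IH ?h // => i ik; apply: h; exact: ltnW.
Qed.

Lemma first_difference (a b : nat -> nat) k : a k <> b k ->
  exists j, [/\ (j <= k)%N, a j <> b j & forall i, (i < j)%N -> a i = b i].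
Proof.
move=> /eqP abk; have ex : exists j, a j != b j by exists k.
exists (ex_minn ex); case: ex_minnP => j abj hj; split; first exact: hj.
  exact/eqP.
move=> i; case: (eqVneq (a i) (b i)) => // /hj; rewrite leqNgt => /negP h /h [].
Qed.

Section Point.
Context {R : realType}.
Implicit Types a b : nat -> nat.

Let partial a k : R := (numerator a k)%:R / (scale k)%:R.

Let scale_gt0R k : 0 < (scale k)%:R :> R.
Proof. by rewrite ltr0n scale_gt0. Qed.

Let radix_gt0R k : 0 < (radix k)%:R :> R.
Proof. by rewrite ltr0n radix_gt0. Qed.

Lemma radix_ge16 k : 16 <= (radix k)%:R :> R.
Proof. by rewrite ler_nat /radix addnC expnD leq_pmulr // expn_gt0. Qed.

Let partialS a k :
  partial a k.+1 = partial a k + (a k)%:R / (scale k.+1)%:R.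
Proof.
rewrite /partial /= scaleS natrD !natrM; field.
by rewrite !gt_eqF.
Qed.

Let partial_le a i j : (i <= j)%N -> partial a i <= partial a j.
Proof.
elim: j => [|j IH]; first by rewrite leqn0 => /eqP ->.
rewrite leq_eqVlt => /predU1P[-> //|/IH h]; apply: le_trans h _.
by rewrite partialS lerDl divr_ge0.
Qed.

(** The intervals from [partial a k] to [upper a k] are nested for sparse [a], because
    [2 * a k + 1 <= radix k]; the expansion lies in all of them. *)
Let upper a k : R := partial a k + (2 * (scale k)%:R)^-1.

Let upper_le a i j : sparse a -> (i <= j)%N -> upper a j <= upper a i.
Proof.
move=> ha; elim: j => [|j IH]; first by rewrite leqn0 => /eqP ->.
rewrite leq_eqVlt => /predU1P[-> //|/IH h]; apply: le_trans h.
rewrite /upper partialS -addrA lerD2l scaleS natrM.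
have r16 := radix_ge16 j; have rj := radix_gt0R j; have sj := scale_gt0R j.
have : 3 * (a j)%:R <= (radix j)%:R :> R by rewrite -natrM ler_nat.
move=> h; rewrite -subr_ge0.
rewrite (_ : _ - _ = ((radix j)%:R - 2 * (a j)%:R - 1) /
    (2 * (scale j)%:R * (radix j)%:R)); last by field; rewrite !gt_eqF.
by rewrite divr_ge0 ?mulr_ge0 //; lra.
Qed.

Lemma expansion_bounds a k : sparse a ->
  (numerator a k)%:R <= (scale k)%:R * (expansion a : R) <= (numerator a k)%:R + 2^-1.
Proof.
move=> ha; have hub n m : partial a n <= upper a m.
  case: (leqP n m) => h; first by apply: le_trans (partial_le _ _ _ h) _; rewrite lerDl.
  by apply: le_trans (upper_le _ _ _ ha (ltnW h)); rewrite lerDl.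
have h1 : partial a k <= expansion a.
  apply: ub_le_sup; last by exists k.
  by exists (upper a 0) => _ [n _ <-]; exact: hub.
have h2 : expansion a <= upper a k.
  by apply: ge_sup; [by exists (partial a 0); exists 0%N|move=> _ [n _ <-]; exact: hub].
have sk := scale_gt0R k.
apply/andP; split; first by rewrite mulrC -ler_pdivrMr.
rewrite -(ler_pM2l sk) in h2; apply: le_trans h2 _.
by rewrite le_eqVlt; apply/orP; left; apply/eqP; rewrite /upper /partial; field; rewrite gt_eqF.
Qed.

Lemma digit_bounds a k : sparse a ->
  (a k)%:R <= (radix k)%:R * ((scale k)%:R * (expansion a : R) - (numerator a k)%:R)
    <= (a k)%:R + 2^-1.
Proof.
move=> ha; have := expansion_bounds a k.+1 ha.
by rewrite scaleS /= natrD !natrM => /andP[h1 h2]; apply/andP; split; nra.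
Qed.

Lemma expansion_mem_thin_group (alpha : R) a : sparse a ->
  (forall e, 0 < e -> exists N, forall j, (N <= j)%N -> (a j)%:R <= e * gap alpha j) ->
  thin_group alpha (expansion a).
Proof.
move=> ha hs; apply/thin_groupP => e e0.
have e20 : 0 < e / 2 by rewrite divr_gt0.
have [N hN] := hs _ e20.
exists (maxn N (Num.truncn e^-1)) => j; rewrite geq_max => /andP[/hN h1 h2].
have g0 := gap_gt0 alpha j; rewrite ler_pdivrMr //.
(* The error 1/2 of [digit_bounds] is absorbed because the gaps tend to infinity. *)
have h3 : 1 <= e * gap alpha j.
  rewrite -ler_pdivrMl // mulr1; apply: le_trans (ge_gap alpha j).
  by apply: le_trans (ltW (truncnS_gt _)) _; rewrite ler_nat.
have /andP[h4 h5] := digit_bounds a j ha.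
have := dist_int_le R ((scale j)%:R * expansion a) (numerator a j)%:Z.
rewrite -(ler_pM2l (radix_gt0R j)) => h6; apply: le_trans h6 _.
rewrite ger0_norm; first lra.
by rewrite -(pmulr_rge0 _ (radix_gt0R j)); apply: le_trans h4.
Qed.

(** The common prefix cancels, and both errors from [digit_bounds] lie between 0 and 1/2, so their
    difference has modulus at most 1/2. *)
Lemma expansion_difference a b k : sparse a -> sparse b ->
  (forall i, (i < k)%N -> a i = b i) ->
  `|(radix k)%:R * ((scale k)%:R * (expansion a - expansion b)) - ((a k)%:R - (b k)%:R)|
    <= 2^-1 :> R.
Proof.
move=> ha hb /eq_numerator ab.
have := digit_bounds a k ha; have := digit_bounds b k hb; rewrite ab.
set p := expansion a; set q := expansion b => /andP[h1 h2] /andP[h3 h4].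
by rewrite ler_norml; apply/andP; split; lra.
Qed.

Lemma digits_distance a b k : a k <> b k -> 1 <= `|(a k)%:R - (b k)%:R| :> R.
Proof.
move=> /eqP; rewrite ler_normr neq_ltn => /orP[h|h]; apply/orP; [right|left];
  by move: h; rewrite -(ler_nat R) -natr1; lra.
Qed.

(** At the first difference [j < k] the digits are at least 1 apart and the error is at most 1/2, so
    the points differ by at least half a unit of level [j.+1]. *)
Lemma expansion_separation a b k : sparse a -> sparse b ->
  (exists2 i, (i < k)%N & a i <> b i) ->
  (2 * (scale k)%:R)^-1 <= `|expansion a - expansion b| :> R.
Proof.
move=> ha hb [i0 i0k /first_difference[j [ji0 abj eqab]]].
have h := expansion_difference a b j ha hb eqab.
have h1 := digits_distance a b j abj.
have sr : 0 < (scale j.+1)%:R :> R by [].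
have : 2^-1 <= (scale j.+1)%:R * `|expansion a - expansion b| :> R.
  rewrite -(ger0_norm (ltW sr)) -normrM.
  move: h; rewrite [(radix j)%:R * _](_ : _ = (scale j.+1)%:R * (expansion a - expansion b)).
    set x := _ * _; set y := (a j)%:R - (b j)%:R in h1 * => h.
    have h5 := lerB_dist y x; rewrite (distrC y x) in h5. lra.
  by rewrite scaleS natrM; ring.
rewrite -ler_pdivrMl // => h2; apply: le_trans h2.
rewrite -invfM mulrC lef_pV2 ?posrE ?mulr_gt0 // ler_pM2r //.
rewrite ler_nat leq_scale //; exact: leq_ltn_trans i0k.
Qed.

(** Sparse digits differ by at most a third of the radix, so the scaled difference has modulus below
    1/2 and its distance to the integers is that modulus. The error 1/2 costs at most half of a
    digit difference that is at least 1. *)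
Lemma defect_difference (alpha : R) a b k : sparse a -> sparse b -> a k <> b k ->
  (forall i, (i < k)%N -> a i = b i) ->
  `|(a k)%:R - (b k)%:R| / 2 <= defect alpha k (expansion a - expansion b) * gap alpha k.
Proof.
move=> ha hb abk eqab.
have h := expansion_difference a b k ha hb eqab.
have h1 := digits_distance a b k abk.
have rk := radix_gt0R k; have r16 := radix_ge16 k.
rewrite /defect divfK ?gt_eqF ?gap_gt0 //.
move: h; set y := (a k)%:R - (b k)%:R in h1 *; set x := (scale k)%:R * _ => h.
have hy : `|y| <= (radix k)%:R / 3.
  have : 3 * (a k)%:R <= (radix k)%:R :> R by rewrite -natrM ler_nat.
  have : 3 * (b k)%:R <= (radix k)%:R :> R by rewrite -natrM ler_nat.
  have a0 : 0 <= (a k)%:R :> R by [].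
  have b0 : 0 <= (b k)%:R :> R by [].
  by rewrite ler_norml /y => ? ?; apply/andP; split; lra.
have rx : `|(radix k)%:R * x| = (radix k)%:R * `|x| by rewrite normrM (ger0_norm (ltW rk)).
have h2 := lerB_dist y ((radix k)%:R * x).
have h3 := lerB_dist ((radix k)%:R * x) y.
rewrite (distrC y) in h2.
rewrite dist_int_small; first lra.
rewrite -(ltr_pM2l rk); lra.
Qed.

End Point.

(** * Disjoint families in sigma-finite sets *)

Lemma uncountable_nat_bool : ~ countable [set: nat -> bool].
Proof.
(* Cantor's diagonal: [s] flips, at each [n], the value at [n] of the sequence coded by [n]. *)
move=> /countable_injP[f finj].
pose s n := ~~ `[< exists t, f t = n /\ t n >].
have : s (f s) = ~~ s (f s).
  rewrite {1}/s; congr (~~ _); apply/idP/idP => [/asboolP[t [fts ts]]|h].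
    by have e : t = s by [apply: finj; rewrite ?inE]; rewrite -[X in X (f s)]e.
  by apply/asboolP; exists s.
by case: (s (f s)).
Qed.

Lemma exists_nat_inv_lt {R : realType} (e : R) : 0 < e ->
  exists p : nat, p.+1%:R^-1 < e.
Proof.
move=> e0; exists (Num.truncn e^-1).
by rewrite -[ltRHS]invrK ltf_pV2 ?posrE ?invr_gt0 // truncnS_gt.
Qed.


Section CountableChainCondition.
Context {d : measure_display} {T : measurableType d} {R : realType}.
Context (mu : {measure set T -> \bar R}).

(** An infinite [D] would supply more than [mu F / e] disjoint subsets of [F], each of measure at
    least [e]. *)
Lemma finite_disjoint_family {I : pointedType} (K : I -> set T) (F : set T)
    (D : set I) (e : R) : 0 < e -> measurable F -> (mu F < +oo)%E ->
  (forall i, measurable (K i)) -> (forall i, K i `<=` F) -> trivIset D K ->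
  (forall i, D i -> (e%:E <= mu (K i))%E) -> finite_set D.
Proof.
move=> e0 mF Foo mK KF tK De; apply: contrapT => /infiniteP/pcard_leP[u].
have Du n : D (u n) by apply: (@funS _ _ _ _ u).
have uinj : injective u by move=> m n h; apply: (@inj _ _ _ u) => //; rewrite inE.
have muF : mu F = (fine (mu F))%:E by rewrite fineK // ge0_fin_numE.
pose N := (Num.truncn (fine (mu F) / e)).+1.
have : (mu (\bigcup_(i < N) K (u i)) <= mu F)%E.
  apply: le_measure; rewrite ?inE //; first exact: bigcup_measurable.
  by move=> x [i _ /KF].
have mKu n : measurable ((K \o u) n) by exact: mK.
have tKu : trivIset setT (K \o u).
  by move=> m n _ _ h; apply: uinj; exact: (tK _ _ (Du m) (Du n) h).
rewrite bigcup_mkord (@measure_bigsetU _ _ _ mu (K \o u)) //.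
apply/negP; rewrite -ltNge muF.
apply: (@lt_le_trans _ _ (\sum_(i < N) e%:E)%E); last first.
  by apply: lee_sum => i _; exact: De.
rewrite sumEFin lte_fin sumr_const card_ord -mulr_natl -ltr_pdivrMr //.
exact: truncnS_gt.
Qed.

Lemma sigma_finite_countable_disjoint_family {I : pointedType} (K : I -> set T)
    (B : set T) : sigma_finite B mu ->
  (forall i, measurable (K i)) -> (forall i, K i `<=` B) -> trivIset setT K ->
  (forall i, (0 < mu (K i))%E) -> countable [set: I].
Proof.
move=> [F BF mF] mK KB tK K0.
(* Each index is sorted by a piece [F n] that its set meets in positive measure and by a lower bound
   [1 / (q + 1)] for that measure; every class is finite. *)
pose D nq := [set i | ((nq.2.+1%:R^-1 : R)%:E <= mu (K i `&` F nq.1))%E].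
have -> : [set: I] = \bigcup_(nq in [set: nat * nat]) D nq.
  apply/seteqP; split=> // i _.
  have [n Kn] : exists n, (0 < mu (K i `&` F n))%E.
    apply: contrapT => /forallNP h; have := K0 i; apply/negP; rewrite -leNgt.
    have KE : K i = \bigcup_n (K i `&` F n).
      by rewrite -setI_bigcupr -BF; apply/esym/setIidl; exact: KB.
    have mKF n : measurable (K i `&` F n) by apply: measurableI => //; have [] := mF n.
    have : mu.-negligible (\bigcup_n (K i `&` F n)).
      apply: negligible_bigcup => n; apply/negligibleP => //.
      by apply/eqP; rewrite eq_le measure_ge0 andbT leNgt; apply/negP; exact: h.
    by rewrite -KE => /(measure_negligible (mK i)) ->; rewrite lexx.
  have mKF : measurable (K i `&` F n) by apply: measurableI => //; have [] := mF n.
  have fKn : mu (K i `&` F n) \is a fin_num.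
    rewrite ge0_fin_numE //; have [mFn] := mF n; apply: le_lt_trans.
    by apply: le_measure; rewrite ?inE //; exact: subIsetr.
  have fp : 0 < fine (mu (K i `&` F n)) by rewrite -lte_fin fineK.
  have [q hq] := exists_nat_inv_lt _ fp.
  by exists (n, q) => //; rewrite /D /= -[leRHS]fineK // lee_fin ltW.
apply: bigcup_countable => // -[n q] _; apply: finite_set_countable.
have [mFn Fnoo] := mF n.
apply: (@finite_disjoint_family _ (fun i => K i `&` F n) (F n) _ q.+1%:R^-1) => //.
- by move=> i; exact: measurableI.
- by move=> i j _ _ [x [[? _] [? _]]]; apply: (tK i j) => //; exists x.
Qed.

End CountableChainCondition.

(** * Immeasurability *)

Lemma gap_le {R : realType} (alpha : R) j : alpha <= 1 ->
  3 * gap alpha j <= (radix j)%:R.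
Proof.
move=> a1; have r16 := @radix_ge16 R j.
have h1 : (radix j)%:R `^ alpha <= (radix j)%:R :> R by apply: ler1_powR; lra.
have h2 : (radix j)%:R `^ alpha / (j + 4)%:R <= (radix j)%:R / 4 :> R.
  by rewrite ler_pM ?powR_ge0 // lef_pV2 ?posrE ?ltr0n ?addn4 // ler_nat.
have h3 : 16 * j.+1%:R <= (radix j)%:R :> R.
  by rewrite -natrM ler_nat /radix addnC expnD leq_mul // ltn_expl.
rewrite /gap; lra.
Qed.

Lemma half_le_truncn {R : realType} (x : R) : 1 <= x -> x / 2 <= (Num.truncn x)%:R.
Proof.
move=> x1; have /andP[_] := truncn_itv (le_trans ler01 x1).
have : 1 <= (Num.truncn x)%:R :> R by rewrite ler1n truncn_gt0.
by rewrite -natr1; lra.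
Qed.

(* The digits are chosen much larger than the defects of [K], so that no
   difference of two points is a difference of two elements of [K]. *)
Lemma uncountable_disjoint_translates {R : realType} (alpha : R) (K : set R)
    (M : nat -> R) : alpha <= 1 ->
  (forall j x, K x -> defect alpha j x <= M j) -> (forall j, 0 <= M j) ->
  (forall e : R, 0 < e -> exists N, forall j, (N <= j)%N -> M j <= e) ->
  exists b : (nat -> bool) -> R,
    [/\ forall s, thin_group alpha (b s) &
      forall s t x y, K x -> K y -> x + b s = y + b t -> s = t].
Proof.
move=> a1 KM M0 Mlim.
(* Since [w] tends to 0, digits of size [w * gap] stay in the group. The term [16 * M j] dominates
   the defects of differences in [K]; the positive term [j.+1%:R^-1] keeps the digits nonzero. *)
pose w j : R := 16 * M j + j.+1%:R^-1.
have wlim e : 0 < e -> exists N, forall j, (N <= j)%N -> w j <= e.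
  move=> e0; have [|N hN] := Mlim (e / 32); first by rewrite divr_gt0.
  have [|p hp] := @exists_nat_inv_lt R (e / 2); first by rewrite divr_gt0.
  exists (maxn N p) => j; rewrite geq_max => /andP[/hN h1 h2].
  have : j.+1%:R^-1 <= p.+1%:R^-1 :> R by rewrite lef_pV2 ?posrE // ler_nat.
  move: hp h1; rewrite /w; move: (M j) (j.+1%:R^-1) (p.+1%:R^-1) => m y z.
  lra.
have [N wN] := wlim 1 ltr01.
pose u j := Num.truncn (w j * gap alpha j).
have wg1 j : 1 <= w j * gap alpha j.
  have h : j.+1%:R^-1 * j.+1%:R = 1 :> R by rewrite mulVf.
  rewrite -{}h ler_pM // ?ge_gap // /w lerDr mulr_ge0 //.
have u_le j : (u j)%:R <= w j * gap alpha j.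
  by rewrite truncn_le; exact: le_trans ler01 (wg1 j).
have u_ge j : w j * gap alpha j / 2 <= (u j)%:R by exact: half_le_truncn.
(* Digits below [N] vanish, and from [N] on [w <= 1] bounds them by the gap, which ensures sparsity.
   The bits of [s] are read from position [N]. *)
pose a (s : nat -> bool) j := if (j < N)%N then 0%N else (s (j - N) * u j)%N.
have a_le s j : (N <= j)%N -> (a s j <= u j)%N.
  by rewrite /a ltnNge => -> /=; case: (s _); rewrite ?mul1n.
have a_sparse s : sparse (a s).
  move=> j; case: (leqP N j) => [Nj|jN]; last by rewrite /a jN.
  rewrite -(ler_nat R) natrM; apply: le_trans (gap_le alpha j a1).
  rewrite ler_pM2l //; apply: le_trans (_ : (u j)%:R <= _); first by rewrite ler_nat a_le.
  apply: le_trans (u_le j) _; rewrite -[leRHS]mul1r ler_pM2r ?gap_gt0 //; exact: wN.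
exists (fun s => expansion (a s)); split=> [s|s t x y Kx Ky].
  apply: expansion_mem_thin_group => // e e0; have [N' hN'] := wlim e e0.
  exists (maxn N N') => j; rewrite geq_max => /andP[Nj /hN' we].
  apply: le_trans (_ : (u j)%:R <= _); first by rewrite ler_nat a_le.
  by apply: le_trans (u_le j) _; rewrite ler_pM2r ?gap_gt0.
move=> xy; apply: contrapT => st.
have [i sti] : exists i, s i <> t i.
  by apply: contrapT => /forallNP h; apply: st; apply/funext => i; apply: contrapT; exact: h.
have gap0 := gap_gt0 alpha.
have u0 j : (0 < u j)%N by rewrite truncn_gt0 wg1.
have : a s (i + N)%N <> a t (i + N)%N.
  rewrite /a ltnNge leq_addl /= addnK; have := u0 (i + N)%N.
  by case: (s i) (t i) sti => -[] // _; rewrite mul1n mul0n; case: (u _).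
move=> /first_difference[j [_ abj eqab]].
have Nj : (N <= j)%N by rewrite leqNgt; apply/negP => jN; apply: abj; rewrite /a jN.
have := defect_difference alpha _ _ _ (a_sparse s) (a_sparse t) abj eqab.
have -> : `|(a s j)%:R - (a t j)%:R| = (u j)%:R :> R.
  move: abj; rewrite /a ltnNge Nj /=; case: (s _); case: (t _);
  rewrite ?mul1n ?mul0n ?subrr ?subr0 ?sub0r ?normrN ?ger0_norm //.
have -> : expansion (a s) - expansion (a t) = y - x by lra.
have := defectB alpha j y x; have := KM j x Kx; have := KM j y Ky.
have := u_ge j; have := M0 j; have j0 : 0 < j.+1%:R^-1 :> R by [].
move: (gap0 j); set g := gap alpha j; set D := defect alpha j (y - x).
move=> g0 M0j ug Dy Dx DD uD.
(* One factor 2 is lost by truncation and one by [defect_difference]. The result exceeds [2 * M j],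
   the largest defect possible for [y - x]. *)
have : w j / 4 <= D.
  rewrite -(ler_pM2r g0); move: ug uD; rewrite -/g.
  by move: (w j) (u j)%:R => z v; lra.
rewrite /w; move: (j.+1%:R^-1) j0 => z; lra.
Qed.

Section Immeasurable.
Context {R : realType} (alpha : R) (S : set (set R)).
Context (mu : {measure set (g_sigma_algebraType S) -> \bar R}).
Context (sigmaS : sigma_algebra setT S).
Context (borelS : (measurable : set (set R)) `<=` S).

(** Egorov's theorem with an exceptional set of measure below half of [mu A]: what remains cannot be
    null. *)
Lemma exists_uniform_subset (A : set R) : S A -> A `<=` thin_group alpha ->
  (0 < mu A)%E -> (mu A < +oo)%E ->
  exists K, [/\ S K, K `<=` A, (0 < mu K)%E &
    forall e, 0 < e -> exists N, forall j x, (N <= j)%N -> K x -> defect alpha j x <= e].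
Proof.
move=> SA AB mA0 mAoo.
have SE : @measurable _ (g_sigma_algebraType S) = S by exact: sigma_algebra_id.
have finA : mu A = (fine (mu A))%:E by rewrite fineK // ge0_fin_numE.
have e0 : 0 < fine (mu A) / 2 by rewrite divr_gt0 // -lte_fin -finA.
have mdef j : @measurable_fun _ _ (g_sigma_algebraType S) R A (defect alpha j).
  move=> mA Y mY; rewrite SE; have := measurable_defect alpha j measurableT Y mY.
  rewrite setTI => /borelS SY; rewrite -SE; apply: measurableI => //.
  by rewrite SE.
have mA : @measurable _ (g_sigma_algebraType S) A by rewrite SE.
have [B [mB Be unif]] := @pointwise_almost_uniform _ R (g_sigma_algebraType S) mu
  (fun j => defect alpha j) (fun=> 0) A _ mdef mA mAoo AB e0.
exists (A `\` B); split.
- by rewrite -SE; apply: measurableD.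
- exact: subDsetl.
- rewrite ltNge; apply/negP => h.
  have : (mu A <= mu (A `\` B) + mu B)%E.
    apply: le_trans (measureU2 _ _ _) => //; last exact: measurableD.
    apply: le_measure; rewrite ?inE //.
      by apply: measurableU => //; exact: measurableD.
    by move=> x Ax; case: (pselect (B x)) => Bx; [right|left].
  move: h; rewrite le_eqVlt ltNge measure_ge0 orbF => /eqP ->; rewrite add0e.
  by move=> /le_lt_trans/(_ Be); rewrite finA lte_fin; lra.
- move=> e e0'.
  (* Uniform convergence comes as a filter limit, so the strict [e]-tube around 0 has to be
     exhibited as a neighbourhood. *)
  have : nbhs ((fun=> 0) : {uniform` (A `\` B) -> R}) [set h | forall y, (A `\` B) y -> `|h y| < e].
    apply/uniform_nbhs; exists [set xy | `|xy.1 - xy.2| < e]; split.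
      by rewrite -entourage_ballE; exists e.
    by move=> h /= he y Ky; rewrite -normrN -sub0r; exact: he.
  move=> /unif [N _ hN]; exists N => j x Nj Kx.
  have := hN j Nj x Kx; rewrite ger0_norm ?defect_ge0 //; exact: ltW.
Qed.

End Immeasurable.

Lemma immeasurable_thin_group {R : realType} (alpha : R) : alpha <= 1 ->
  immeasurable (thin_group alpha).
Proof.
move=> a1; split; first by exists 0; exact: thin_group0.
  exact: measurable_thin_group.
move=> S mu sigmaS borelS trans; 
have SE : @measurable _ (g_sigma_algebraType S) = S by exact: sigma_algebra_id.
have [sfin|] := pselect (@sigma_finite _ (g_sigma_algebraType S) R (thin_group alpha) mu);
  last by right.
left; apply: contrapT => muB; have [F BF mF] := sfin.
have [n Fn0] : exists n, mu (F n) <> 0%E.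
  apply: contrapT => /forallNP h; apply: muB; rewrite BF.
  apply: measure_negligible; first by apply: bigcup_measurable => k _; have [] := mF k.
  apply: negligible_bigcup => k; apply/negligibleP; first by have [] := mF k.
  exact: contrapT (h k).
have FB : F n `<=` thin_group alpha by rewrite BF => x Fx; exists n.
have [mFn Fnoo] := mF n.
have SFn : S (F n) by move: mFn; rewrite SE.
have Fn_gt0 : (0 < mu (F n))%E by rewrite lt0e measure_ge0 andbT; exact/eqP.
have [K [SK KF K0 unif]] := exists_uniform_subset _ _ _ sigmaS borelS _ SFn FB Fn_gt0 Fnoo.
have /set0P[x0 Kx0] : K != set0 by apply: contraTneq K0 => ->; rewrite measure0 ltxx.
(* The supremum is finite because defects are at most [radix j], and it tends to 0 by uniformity on
   [K]. *)
pose M j := sup [set defect alpha j x | x in K].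
have MK j x : K x -> defect alpha j x <= M j.
  move=> Kx; apply: ub_le_sup; last by exists x.
  by exists (radix j)%:R => _ [y _ <-]; exact: defect_le_radix.
have M0 j : 0 <= M j by exact: le_trans (defect_ge0 alpha j x0) (MK j x0 Kx0).
have Mlim e : 0 < e -> exists N, forall j, (N <= j)%N -> M j <= e.
  move=> /unif[N hN]; exists N => j Nj; apply: ge_sup; first by exists (defect alpha j x0); exists x0.
  by move=> _ [x Kx <-]; exact: hN.
have [b [bB binj]] := uncountable_disjoint_translates _ _ _ a1 MK M0 Mlim.
(* The translates of [K] are disjoint subsets of the group with the same positive measure, so
   sigma-finiteness would make their index set countable. *)
apply: uncountable_nat_bool.
apply: (@sigma_finite_countable_disjoint_family _ (g_sigma_algebraType S) R mu
  _ (fun s => [set x + b s | x in K]) _ sfin).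
- by move=> s; rewrite SE; have [] := trans K (b s) SK.
- by move=> s _ [x Kx <-]; apply: thin_groupD => //; exact/FB/KF.
- by move=> s t _ _ [_ [[x Kx <-] [y Ky] yx]]; apply: (binj s t x y).
- by move=> s; have [_ ->] := trans K (b s) SK.
Qed.

(** * Growth estimates *)

Section Growth.
Context {R : realType}.
Implicit Types alpha s t c delta x : R.

Let radix_gt0R j : 0 < (radix j)%:R :> R.
Proof. by rewrite ltr0n radix_gt0. Qed.

Let powRD_gt0 x s t : 0 < x -> x `^ (s + t) = x `^ s * x `^ t.
Proof. by move=> x0; rewrite powRD // (gt_eqF x0) implybT. Qed.

Lemma exists_nat_ge (x : R) : exists N : nat, forall j, (N <= j)%N -> x <= j%:R.
Proof.
exists (Num.truncn x).+1 => j Nj; apply: le_trans (ltW (truncnS_gt x)) _.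
by rewrite ler_nat.
Qed.

Lemma radix_powR_growth c delta : 0 < delta ->
  exists J, forall j, (J <= j)%N -> c * (j + 4)%:R ^+ 2 <= (radix j)%:R `^ delta.
Proof.
move=> d0; have l0 : 0 < ln 2 :> R by rewrite ln_gt0 // ltr1n.
pose b := delta * ln 2; have b0 : 0 < b by rewrite mulr_gt0.
have [J hJ] := exists_nat_ge (6 * c / b ^+ 3).
exists J => j Jj.
have -> : (radix j)%:R `^ delta = expR (b * (j + 4)%:R).
  by rewrite /powR gt_eqF // /radix natrX lnXn // -(mulr_natr (ln 2)) /b -mulrA.
have n0 : 0 <= (j + 4)%:R :> R by [].
(* The cubic Taylor term of the exponential beats the quadratic; the 6 in the choice of [J] is its
   [3!]. *)
have := @expR_ge1Dxn R (b * (j + 4)%:R) 2 (mulr_ge0 (ltW b0) n0).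
move=> hexp. apply: le_trans hexp; rewrite exprMn (_ : 3`! = 6%N) //.
have : 6 * c <= b ^+ 3 * (j + 4)%:R.
  rewrite -ler_pdivrMl ?exprn_gt0 // mulrC; apply: le_trans (hJ j Jj) _.
  by rewrite ler_nat leq_addr.
move: (b ^+ 3) (j + 4)%:R n0 => B n n0 h.
have : 6 * c * n ^+ 2 <= B * n * n ^+ 2 by rewrite ler_wpM2r // exprn_ge0.
by rewrite [B * n ^+ 3](_ : _ = B * n * n ^+ 2); [lra | ring].
Qed.

Lemma gap_le_radix_powR alpha t : 0 <= alpha -> alpha < t ->
  exists J, forall j, (J <= j)%N -> 5 * gap alpha j <= (radix j)%:R `^ t.
Proof.
move=> a0 at'; have [|J hJ] := radix_powR_growth 10 (t - alpha); first by rewrite subr_gt0.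
exists J => j /hJ h.
have r1 : 1 <= (radix j)%:R `^ alpha :> R.
  by rewrite -[leLHS](powRr0 (radix j)%:R) ler_powR // ler1n radix_gt0.
rewrite -(subrK alpha t) powRD_gt0 //.
set p := _ `^ (t - alpha) in h *; set q := _ `^ alpha in r1 *.
have : 10 * (j + 4)%:R ^+ 2 * q <= p * q by rewrite ler_wpM2r //; lra.
move=> hpq; apply: le_trans hpq; rewrite /gap -/q.
have n4 : 4 <= (j + 4)%:R :> R by rewrite ler_nat leq_addl.
have jn : j.+1%:R <= (j + 4)%:R :> R by rewrite ler_nat; lia.
move: ((j + 4)%:R) (j.+1%:R) n4 jn => n m n4 jn.
have n0 : 0 < n by lra.
have e1 : q / n <= q by rewrite ler_pdivrMr // ler_peMr; lra.
have e2 : q <= n * q by rewrite ler_peMl; lra.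
have e3 : n * q <= n ^+ 2 * q by rewrite expr2 -mulrA ler_peMl; lra.
have e4 : n <= n * q by rewrite ler_peMr; lra.
lra.
Qed.

Lemma radix_powR_le_gap alpha t : t < alpha ->
  exists J, forall j, (J <= j)%N ->
    (radix j)%:R `^ t <= gap alpha j / j.+1%:R.
Proof.
move=> at'; have [|J hJ] := radix_powR_growth 1 (alpha - t); first by rewrite subr_gt0.
exists J => j /hJ; rewrite mul1r => h.
have aE : alpha = alpha - t + t by ring.
rewrite ler_pdivlMr // /gap {1}aE powRD_gt0 //.
set p := _ `^ (alpha - t) in h *; set q := _ `^ t.
have q0 : 0 <= q by exact: powR_ge0.
have n4 : 4 <= (j + 4)%:R :> R by rewrite ler_nat leq_addl.
have jn : j.+1%:R <= (j + 4)%:R :> R by rewrite ler_nat; lia.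
have m0 : 0 <= j.+1%:R :> R by [].
move: ((j + 4)%:R) (j.+1%:R) n4 jn m0 h => n m n4 jn m0 h.
have n0 : 0 < n by lra.
have : q * m <= p * q / n.
  rewrite ler_pdivlMr //.
  have : q * n ^+ 2 <= q * p by rewrite ler_wpM2l.
  have : m * n <= n ^+ 2 by nra.
  nra.
lra.
Qed.

(** The finitely many factors before [J] are absorbed into the constant. *)
Lemma prod_eventually_le (u v : nat -> R) (J : nat) :
  (forall j, 0 < u j) -> (forall j, 0 < v j) ->
  (forall j, (J <= j)%N -> u j <= v j) ->
  exists2 D, 0 < D & forall k, (J <= k)%N -> \prod_(j < k) u j <= D * \prod_(j < k) v j.
Proof.
move=> u0 v0 uv.
have pu k : 0 < \prod_(j < k) u j by apply: prodr_gt0.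
have pv k : 0 < \prod_(j < k) v j by apply: prodr_gt0.
exists ((\prod_(j < J) u j) / \prod_(j < J) v j); first by rewrite divr_gt0.
move=> k /subnKC <-; elim: (k - J)%N => [|n IH]; first by rewrite addn0 divfK // gt_eqF.
rewrite addnS !big_ord_recr /= mulrA; apply: ler_pM => //; [exact: (ltW (pu _))|exact: (ltW (u0 _))|].
by apply: uv; rewrite leq_addr.
Qed.

Lemma scale_powR k t : (scale k)%:R `^ t = \prod_(j < k) (radix j)%:R `^ t :> R.
Proof.
elim: k => [|k IH]; first by rewrite /scale !big_ord0 powR1.
by rewrite scaleS natrM powRM // IH big_ord_recr.
Qed.

Lemma sqr_scale_ge k : (2 ^ (k * k) <= scale k ^ 2)%N.
Proof.
elim: k => [|k IH]; first by rewrite /scale big_ord0.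
rewrite scaleS expnMn /radix -expnM; apply: leq_trans (leq_mul IH (leqnn _)).
by rewrite -expnD leq_exp2l //; lia.
Qed.

Lemma scale_ge k : (k <= scale k)%N.
Proof.
rewrite -(@leq_exp2r _ _ 2) //; apply: leq_trans (sqr_scale_ge k).
by apply: ltnW; exact: ltn_expl.
Qed.

(** The base 2 exponent of [radix k] is linear in [k], that of [scale k] quadratic. Hence passing
    from one scale to the next costs less than any positive power of the scale. *)
Lemma scale_powR_growth c t delta : 0 <= t -> 0 < delta ->
  exists J, forall k, (J <= k)%N -> c * (radix k)%:R `^ t <= (scale k)%:R `^ delta.
Proof.
move=> t0 d0; have [J hJ] := exists_nat_ge (2 / delta * (1 + 2 * t)).
have [J' hJ'] := exists_nat_ge c.
exists (maxn 4 (maxn J J')) => k; rewrite !geq_max => /and3P[k4 /hJ hk /hJ' hc].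
have k2 : 1 <= (2 ^ k)%:R :> R by rewrite ler1n expn_gt0.
have k0 : 0 < (2 ^ k)%:R :> R by lra.
(* This uses [k + 4 <= 2 * k], hence the bound 4 in the witness. *)
have h1 : (radix k)%:R `^ t <= (2 ^ k)%:R `^ (2 * t).
  rewrite powRrM; apply: ge0_ler_powR => //; rewrite ?nnegrE ?powR_ge0 //.
  rewrite powR_mulrn // -natrX ler_nat /radix -expnM leq_exp2l //; lia.
have h2 : (2 ^ k)%:R `^ (1 + 2 * t) <= (scale k)%:R `^ delta.
  apply: (@le_trans _ _ ((2 ^ k)%:R `^ (k%:R * (delta / 2)))).
    apply: ler_powR => //; rewrite -ler_pdivrMr; last by rewrite divr_gt0.
    by rewrite invf_div mulrC.
  rewrite powRrM powR_mulrn // -natrX -expnM.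
  have -> : (scale k)%:R `^ delta = (scale k ^ 2)%:R `^ (delta / 2) :> R.
    by rewrite natrX -powR_mulrn // -powRrM mulrC divfK.
  have d2 : 0 <= delta / 2 by rewrite divr_ge0 // ltW.
  apply: ge0_ler_powR; rewrite ?nnegrE //.
  by rewrite ler_nat sqr_scale_ge.
apply: le_trans h2; rewrite powRD_gt0 // (powRr1 (ltW k0)).
have kc : c <= (2 ^ k)%:R.
  by apply: le_trans hc _; rewrite ler_nat ltnW // ltn_expl.
apply: (@le_trans _ _ ((2 ^ k)%:R * (radix k)%:R `^ t)).
  by rewrite ler_wpM2r // powR_ge0.
by rewrite ler_wpM2l // ltW.
Qed.

End Growth.

(** * Upper bound for the packing dimension *)

Definition int_ball (c : int) (b : nat) : seq int :=
  [seq c + i%:Z - b%:Z | i <- iota 0 (2 * b + 1)].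

Lemma mem_int_ball c b (n : int) : (`|n - c| <= b)%N -> n \in int_ball c b.
Proof.
move=> h; apply/mapP; exists (absz (n - c + b%:Z)); last by lia.
by rewrite mem_iota; lia.
Qed.

Lemma size_int_ball c b : size (int_ball c b) = (2 * b + 1)%N.
Proof. by rewrite size_map size_iota. Qed.

Section CoveringNumber.
Context {R : realType}.
Implicit Types (A : set R) (e s : R).

Lemma covering_number_le A e (T : seq R) :
  A `<=` \bigcup_(x in [set` T]) closed_ball x e ->
  (covering_number A e <= (size T)%:R%:E)%E.
Proof. by move=> AT; apply: ereal_inf_lbound; exists T. Qed.

Lemma covering_number_ge0 A e : (0 <= covering_number A e)%E.
Proof. by apply: le_ereal_inf_tmp => _ [T _ <-]; rewrite lee_fin. Qed.

Lemma upper_minkowski_dim_ge0 A : (0 <= upper_minkowski_dim A)%E.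
Proof. by apply: le_ereal_inf_tmp => _ [s [s0 _] <-]; rewrite lee_fin. Qed.

Lemma upper_minkowski_dim_le A s : 0 <= s ->
  (forall eps, 0 < eps -> exists2 d, 0 < d & forall e, 0 < e < d ->
    (covering_number A e * (e `^ s)%:E <= eps%:E)%E) ->
  (upper_minkowski_dim A <= s%:E)%E.
Proof.
move=> s0 h; apply: ereal_inf_lbound; exists s => //; split => //.
apply/eqP; rewrite eq_le; apply/andP; split; last first.
  rewrite limf_esupE; apply: le_ereal_inf_tmp => _ [V FV <-].
  have [x Vx] : V !=set0 by exact: (@filter_ex _ (0 : R)^'+).
  apply: (@le_trans _ _ (covering_number A x * (x `^ s)%:E)%E).
    by rewrite mule_ge0 ?covering_number_ge0 // lee_fin powR_ge0.
  by apply: ereal_sup_ubound; exists x.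
apply/lee_addgt0Pr => eps eps0; rewrite add0e.
have [d d0 hd] := h eps eps0.
rewrite limf_esupE.
apply: (@le_trans _ _ (ereal_sup [set (covering_number A e * (e `^ s)%:E)%E | e in `]0, d[%classic])).
  apply: ereal_inf_lbound; exists `]0, d[%classic => //.
  by near=> e; rewrite /= in_itv /=; apply/andP; split; near: e;
    [exact: nbhs_right_gt|exact: nbhs_right_lt].
by apply: ge_ereal_sup => _ [e + <-]; rewrite /= in_itv /= => /hd.
Unshelve. all: by end_near. Qed.

End CoveringNumber.

Section UpperBound.
Context {R : realType} (alpha : R).
Context (alpha01 : 0 <= alpha <= 1).

(** Convergence to 0 gives a defect bound of 1 from some index on; fixing that index makes the count
    of cylinders uniform over the piece. *)
Definition thin_piece (N : nat) : set R :=
  [set x | [/\ thin_group alpha x, `|x| <= N%:R &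
    forall j, (N <= j)%N -> defect alpha j x <= 1]].

Lemma thin_group_pieces : thin_group alpha = \bigcup_N thin_piece N.
Proof.
apply/seteqP; split=> x; last by move=> [N _ []].
move=> Bx; have /thin_groupP/(_ 1 ltr01)[N hN] := Bx.
have [N' hN'] := exists_nat_ge `|x|.
exists (maxn N N') => //; split => //; first by apply: hN'; rewrite leq_maxr.
by move=> j; rewrite geq_max => /andP[/hN].
Qed.

Lemma bounded_thin_piece N : bounded_set (thin_piece N).
Proof.
exists N%:R; split => // M NM x [_ xN _]; exact: le_trans xN (ltW NM).
Qed.

Let nearest (y : R) : int := Num.floor (y + 2^-1).

Let radix_gt0R j : 0 < (radix j)%:R :> R.
Proof. by rewrite ltr0n radix_gt0. Qed.

Let scale_gt0R j : 0 < (scale j)%:R :> R.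
Proof. by rewrite ltr0n scale_gt0. Qed.

Lemma nearest_thin_piece N j x : thin_piece N x -> (N <= j)%N ->
  (radix j)%:R * `|(scale j)%:R * x - (nearest ((scale j)%:R * x))%:~R| <= gap alpha j.
Proof.
by move=> [_ _ h] /h; rewrite /defect ler_pdivrMr ?gap_gt0 // mul1r.
Qed.

(** Induction on the level: if [c] is the nearest integer at one level, the next one lies within
    [gap + 1/3] of [radix * c]. That leaves at most [2 * truncn gap + 3 <= 5 * gap] candidates. *)
Lemma nearest_cover N : exists2 D : R, 0 < D & forall k, (N <= k)%N ->
  exists2 L : seq int, (size L)%:R <= D * \prod_(j < k) (5 * gap alpha j) &
    forall x, thin_piece N x -> nearest ((scale k)%:R * x) \in L.
Proof.
have /andP[a0 a1] := alpha01.
have p1 k : 1 <= \prod_(j < k) (5 * gap alpha j).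
  elim: k => [|k IH]; first by rewrite big_ord0.
  by rewrite big_ord_recr /= mulr_ege1 //; have := gap_ge1 alpha k; lra.
pose b := (scale N * N + 1)%N.
exists (2 * b + 1)%:R => // k /subnKC <-; elim: (k - N)%N => [|n [L sL IH]].
  exists (int_ball 0 b).
    by rewrite size_int_ball addn0 ler_peMr.
  move=> x [_ xN _]; apply: mem_int_ball; rewrite subr0 addn0.
  have h : `|(scale N)%:R * x| <= (scale N * N)%:R.
    by rewrite normrM natrM ger0_norm // ler_wpM2l.
  have := dist_int_le_half R ((scale N)%:R * x); rewrite /dist_int -/(nearest _).
  move: (nearest _) => m h2.
  have : `|m%:~R| <= (scale N * N)%:R + 1 :> R.
    have := lerB_dist (m%:~R) ((scale N)%:R * x : R); rewrite distrC; lra.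
  by rewrite /b -intr_norm -natr_absz -(natrD _ _ 1) ler_nat.
pose m := (Num.truncn (gap alpha (N + n)) + 1)%N.
exists [seq z | c <- L, z <- int_ball ((radix (N + n))%:Z * c) m].
  have -> : size [seq z | c <- L, z <- int_ball ((radix (N + n))%:Z * c) m] =
      (size L * (2 * m + 1))%N.
    by rewrite size_allpairs_dep; elim: (L) => //= c l ->; rewrite size_int_ball mulSn.
  rewrite natrM (addnS N n) big_ord_recr /= mulrA; apply: ler_pM => //.
  have g1 := gap_ge1 alpha (N + n).
  have /andP[h _] := truncn_itv (le_trans ler01 g1).
  by rewrite /m natrD natrM natrD; lra.
move=> x Px; apply/allpairsPdep.
have := IH x Px; set c := nearest _ => cL.
exists c, (nearest ((scale (N + n.+1))%:R * x)); split => //.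
apply: mem_int_ball.
have NnN : (N <= N + n)%N by rewrite leq_addr.
have NnN' : (N <= N + n.+1)%N by rewrite leq_addr.
have := nearest_thin_piece _ _ _ Px NnN; have := nearest_thin_piece _ _ _ Px NnN'.
rewrite -/c; set c' := nearest _ => h1 h2.
have g3 := gap_le alpha (N + n.+1) a1.
(* The defect bound at the next level together with [3 * gap <= radix] gives this 1/3. *)
have h3 : `|(scale (N + n.+1))%:R * x - c'%:~R| <= 3^-1.
  rewrite -(ler_pM2l (radix_gt0R (N + n.+1))); lra.
move: h2; rewrite -[X in X * _]ger0_norm // -normrM mulrBr mulrA.
rewrite -natrM mulnC -scaleS -addnS => h2.
have : `|c'%:~R - (radix (N + n))%:R * c%:~R| <= gap alpha (N + n) + 3^-1.
  move: h2 h3; set y := _ * x; set u := _ * c%:~R; set v := c'%:~R => h2 h3.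
  have -> : v - u = (y - u) - (y - v) by ring.
  by apply: le_trans (ler_normB _ _) _; rewrite lerD.
have gt := truncnS_gt (gap alpha (N + n)).
rewrite -[X in X * c%:~R]/((radix (N + n))%:Z%:~R) -intrM -intrB -intr_norm -natr_absz.
move=> h4; rewrite -ltnS -(ltr_nat R); apply: le_lt_trans h4 _.
by rewrite /m addn1 -[ltRHS]natr1; lra.
Qed.

Lemma upper_minkowski_dim_thin_piece N :
  (upper_minkowski_dim (thin_piece N) <= alpha%:E)%E.
Proof.
have /andP[a0 a1] := alpha01.
apply/lee_addgt0Pr => delta d0.
(* Half of [delta] pays for the product of the factors [5 * gap], the other half for the factor
   [radix k] between consecutive scales and for the constants. *)
pose t := alpha + delta / 2; have d20 : 0 < delta / 2 by rewrite divr_gt0.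
have at' : alpha < t by rewrite ltrDl.
have t0 : 0 <= t by lra.
apply: upper_minkowski_dim_le => [|eps eps0]; first lra.
have [D D0 hD] := nearest_cover N.
have [J hJ] := gap_le_radix_powR alpha t a0 at'.
have [||D' D'0 hD'] := prod_eventually_le (fun j => 5 * gap alpha j)
  (fun j => (radix j)%:R `^ t) J _ _ hJ.
- by move=> j; rewrite mulr_gt0 ?gap_gt0.
- by move=> j; rewrite powR_gt0.
have [J' hJ'] := scale_powR_growth (D * D' / eps) t _ t0 d20.
pose K := maxn N (maxn J J').
exists (scale K)%:R^-1; first by rewrite invr_gt0.
move=> e /andP[e0 eK].
have ex : exists k, e^-1 <= (scale k)%:R.
  have [k hk] := exists_nat_ge e^-1; exists k.
  by apply: le_trans (hk k (leqnn k)) _; rewrite ler_nat scale_ge.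
(* The least level is written [k.+1], so that [1 / e] lies between [scale k] and [scale k.+1]; small
   levels are excluded by [e < 1 / scale K]. *)
case: (ex_minnP ex) => -[|k] hk kmin.
  have : e^-1 <= (scale K)%:R by apply: le_trans hk _; rewrite ler_nat leq_scale.
  by rewrite leNgt -(invrK (scale K)%:R) ltf_pV2 ?posrE ?invr_gt0 // eK.
have Kk : (K <= k)%N.
  rewrite leqNgt; apply/negP => kK.
  have : e^-1 <= (scale K)%:R by apply: le_trans hk _; rewrite ler_nat leq_scale.
  by rewrite leNgt -(invrK (scale K)%:R) ltf_pV2 ?posrE ?invr_gt0 // eK.
have ek : e * (scale k)%:R <= 1.
  rewrite -ler_pdivlMl // mulr1 leNgt; apply/negP => /ltW /kmin.
  by rewrite ltnn.
have [Nk Jk J'k] : [/\ (N <= k)%N, (J <= k)%N & (J' <= k)%N].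
  by move: Kk; rewrite /K !geq_max => /and3P.
have [L sL hL] := hD k.+1 (leqW Nk).
pose T : seq R := [seq n%:~R / (scale k.+1)%:R | n <- L].
apply: (@le_trans _ _ ((size T)%:R * e `^ (alpha + delta))%:E).
  rewrite EFinM lee_wpmul2r ?lee_fin ?powR_ge0 //; apply: covering_number_le.
  move=> x Px; exists ((nearest ((scale k.+1)%:R * x))%:~R / (scale k.+1)%:R).
    by apply: map_f; exact: hL.
  rewrite closed_ballE //= /closed_ball_ /=.
  have := dist_int_le_half R ((scale k.+1)%:R * x); rewrite /dist_int -/(nearest _).
  move: (nearest _) => n hn.
  rewrite -(ler_pM2l (scale_gt0R k.+1)) -{1}(ger0_norm (ltW (scale_gt0R k.+1))) -normrM.
  rewrite mulrBr mulrCA divff ?gt_eqF // mulr1 distrC; apply: le_trans hn _.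
  by move: hk; rewrite -[_^-1]mul1r ler_pdivrMr // mulrC; lra.
rewrite lee_fin size_map.
have es : e `^ (alpha + delta) * ((scale k)%:R `^ t * (scale k)%:R `^ (delta / 2)) <= 1.
  rewrite -powRD; last by rewrite (gt_eqF (scale_gt0R k)) implybT.
  have -> : t + delta / 2 = alpha + delta by rewrite /t; lra.
  have e00 := ltW e0; have s00 := ltW (scale_gt0R k).
  have p1 : 1 `^ (alpha + delta) = 1 :> R by rewrite powR1.
  rewrite -powRM // -[leRHS]p1.
  by apply: ge0_ler_powR; rewrite ?nnegrE ?mulr_ge0 //; lra.
have h1 := hJ' k J'k.
have h2 := hD' k.+1 (leqW Jk).
rewrite -scale_powR scaleS natrM powRM // in h2.
have sk0 : 0 <= (scale k)%:R `^ t by exact: powR_ge0.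
move: es h1 h2 sL (powR_ge0 e (alpha + delta)).
move: (_ `^ (alpha + delta)) (_ `^ (delta / 2)) (_ `^ t) ((radix k)%:R `^ t) sk0.
move=> E q p r p0 es h1 h2 sL E0.
have h3 : D * D' * r <= eps * q.
  by rewrite -ler_pdivrMl // mulrA [_ * (D * D')]mulrC.
apply: (@le_trans _ _ (eps * (E * (p * q)))); last first.
  by rewrite -[leRHS]mulr1 ler_wpM2l // ltW.
have h4 : (size L)%:R <= p * (D * D' * r).
  apply: le_trans sL _; apply: le_trans (ler_wpM2l (ltW D0) h2) _.
  by rewrite le_eqVlt; apply/orP; left; apply/eqP; ring.
have h5 : (size L)%:R <= p * (eps * q) by apply: le_trans h4 _; rewrite ler_wpM2l.
apply: le_trans (ler_wpM2r E0 h5) _.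
by rewrite le_eqVlt; apply/orP; left; apply/eqP; ring.
Qed.

End UpperBound.

(** * Lower bound for the packing dimension *)

Lemma upper_minkowski_dim_lt {R : realType} (A : set R) (s : R) :
  (upper_minkowski_dim A < s%:E)%E ->
  exists2 d, 0 < d & forall e, 0 < e < d -> exists T : seq R,
    (size T)%:R <= e `^ (- s) /\ A `<=` \bigcup_(x in [set` T]) closed_ball x e.
Proof.
move=> /ereal_inf_lt[_ [s' [s'0 lim0] <-]]; rewrite lte_fin => ss.
have : (limf_esup (fun e : R => covering_number A e * (e `^ s')%:E) 0^'+ < 1)%E.
  by rewrite lim0 lte_fin.
rewrite limf_esupE => /ereal_inf_lt[_ [V V0 <-] Vlt].
have [d /= d0 dV] := V0.
(* Radii below 1 make the power [- s'] at most the power [- s]. *)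
exists (Num.min d 1); first by rewrite lt_min d0 ltr01.
move=> e /andP[e0]; rewrite lt_min => /andP[ed e1].
have Ve : V e.
  by apply: dV => //=; rewrite sub0r normrN ger0_norm // ltW.
have lt1 : (covering_number A e * (e `^ s')%:E < 1)%E.
  by apply: le_lt_trans Vlt; apply: ereal_sup_ubound; exists e.
have es0 : 0 < e `^ s' by exact: powR_gt0.
have : (covering_number A e < (e `^ (- s'))%:E)%E.
  rewrite ltNge; apply/negP => h; move: lt1; rewrite ltNge => /negP; apply.
  have : ((e `^ (- s'))%:E * (e `^ s')%:E <= covering_number A e * (e `^ s')%:E)%E.
    by rewrite lee_wpmul2r // lee_fin ltW.
  by rewrite -EFinM powRN mulVf // gt_eqF.
move=> /ereal_inf_lt[_ [T AT <-]]; rewrite lte_fin => sT; exists T; split => //.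
apply: le_trans (ltW sT) _; rewrite !powRN lef_pV2 ?posrE ?powR_gt0 //.
by apply: ger_powR; rewrite ?e0 ltW.
Qed.

Fixpoint words (c : nat -> nat) (m : nat) : seq (seq nat) :=
  if m is m'.+1 then [seq rcons w d | w <- words c m', d <- iota 0 (c m').+1]
  else [:: [::]].

Lemma wordsS c m :
  words c m.+1 = [seq rcons w d | w <- words c m, d <- iota 0 (c m).+1].
Proof. by []. Qed.

Lemma size_words c m : size (words c m) = (\prod_(i < m) (c i).+1)%N.
Proof.
elim: m => [|m IH]; first by rewrite big_ord0.
by rewrite big_ord_recr -IH wordsS size_allpairs size_iota.
Qed.

Lemma uniq_words c m : uniq (words c m).
Proof.
elim: m => // m IH; rewrite wordsS; apply: allpairs_uniq => //; first exact: iota_uniq.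
by move=> [w d] [w' d'] _ _ /= /rcons_inj [-> ->].
Qed.

Lemma mem_words c m w : w \in words c m ->
  size w = m /\ forall i, (nth 0 w i <= c i)%N.
Proof.
elim: m w => [|m IH] w; first by rewrite inE => /eqP ->; split=> // i; rewrite nth_nil.
rewrite wordsS => /allpairsP[[v d] [vm dm ->]].
have [sv hv] := IH v vm.
have dc : (d <= c m)%N by have : d \in iota 0 (c m).+1 := dm; rewrite mem_iota.
rewrite size_rcons sv; split=> // i; rewrite nth_rcons sv.
by case: ltngtP => [||->].
Qed.

Section LowerBound.
Context {R : realType} (alpha : R).
Context (alpha1 : alpha <= 1).

(** The divisor [j.+1] makes all admissible digits negligible against the gap. Membership in the
    group then follows from digitwise bounds alone, which survive passage to nested cylinders. *)
Let digit_bound (j : nat) : nat := Num.truncn (gap alpha j / j.+1%:R).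

Let admissible (a : nat -> nat) : Prop := forall j, (a j <= digit_bound j)%N.

Lemma digit_bound_le j : (digit_bound j)%:R <= gap alpha j / j.+1%:R.
Proof.
have h : 0 <= gap alpha j / j.+1%:R by rewrite divr_ge0 // ltW // gap_gt0.
by have /andP[] := truncn_itv h.
Qed.

Lemma admissible_sparse a : admissible a -> sparse a.
Proof.
move=> ha j; rewrite -(ler_nat R) natrM; apply: le_trans (gap_le alpha j alpha1).
rewrite ler_pM2l //; apply: le_trans (_ : (digit_bound j)%:R <= _); first by rewrite ler_nat.
apply: le_trans (digit_bound_le j) _.
by rewrite ler_pdivrMr // ler_peMr ?ler1n // ltW // gap_gt0.
Qed.

Lemma admissible_mem a : admissible a -> thin_group alpha (expansion a).
Proof.
move=> ha; apply: expansion_mem_thin_group; first exact: admissible_sparse.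
move=> e e0; have [p hp] := exists_nat_inv_lt e e0.
exists p => j pj; apply: le_trans (_ : (digit_bound j)%:R <= _); first by rewrite ler_nat.
apply: le_trans (digit_bound_le j) _; rewrite mulrC ler_pM2r ?gap_gt0 //.
by apply: le_trans (ltW hp); rewrite lef_pV2 ?posrE // ler_nat.
Qed.

(** After the prefix of [a] and the word [w], the default of [nth] continues with zeros, which are
    admissible. *)
Let splice (a : nat -> nat) (n : nat) (w : seq nat) (j : nat) : nat :=
  if (j < n)%N then a j else nth 0%N w (j - n).

Lemma splice_admissible a n m w : admissible a ->
  w \in words (fun i => digit_bound (n + i)) m -> admissible (splice a n w).
Proof.
move=> ha /mem_words[_ hw] j; rewrite /splice; case: ltnP => // nj.
by have := hw (j - n)%N; rewrite subnKC.
Qed.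

(* The words of length [m] encode the cylinders of level [n + m] inside a fixed
   cylinder of level [n]. *)
Lemma cylinder_count_growth (s : R) n : 0 <= s < alpha ->
  exists J, forall m, (J <= m)%N ->
    (8 * (scale (n + m))%:R) `^ s <
      (size (words (fun i => digit_bound (n + i)) m))%:R :> R.
Proof.
(* The spare power [t - s] of the scale beats the constants, among them the product [P] over the
   levels below [n]. *)
move=> /andP[s0 sa]; pose t := (s + alpha) / 2.
have st : 0 < t - s by rewrite /t; lra.
have ta : t < alpha by rewrite /t; lra.
have [J hJ] := radix_powR_le_gap alpha t ta.
have [|||D D0 hD] := prod_eventually_le (fun j => (radix j)%:R `^ t)
  (fun j => (digit_bound j).+1%:R) J.
- by move=> j; rewrite powR_gt0 // ltr0n radix_gt0.
- by [].
- by move=> j /hJ h; apply: le_trans h (ltW (truncnS_gt _)).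
pose P : R := \prod_(j < n) (digit_bound j).+1%:R.
have P0 : 0 < P by apply: prodr_gt0.
have [J' hJ'] := scale_powR_growth (D * P * 8 `^ s + 1) 0 _ (lexx 0) st.
exists (maxn J J') => m; rewrite geq_max => /andP[Jm J'm].
have := hJ' (n + m)%N (leq_trans J'm (leq_addl _ _)).
have := hD (n + m)%N (leq_trans Jm (leq_addl _ _)).
rewrite -scale_powR big_split_ord /= -/P powRr0 mulr1.
set W : R := \prod_(i < m) _; have -> : (size (words (fun i => digit_bound (n + i)) m))%:R = W.
  by rewrite size_words natr_prod.
have sc0 : 0 < (scale (n + m))%:R :> R by rewrite ltr0n scale_gt0.
have -> : (scale (n + m))%:R `^ t = (scale (n + m))%:R `^ s * (scale (n + m))%:R `^ (t - s) :> R.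
  by rewrite -powRD ?[s + _]addrC ?subrK // (gt_eqF sc0) implybT.
rewrite powRM // ?(ltW sc0) //.
have : 0 < (scale (n + m))%:R `^ s by rewrite powR_gt0.
move: (_ `^ s) (_ `^ (t - s)) (8 `^ s) => S Q E S0 h1 h2.
have h3 : S * (D * P * E + 1) <= D * (P * W).
  by apply: le_trans h1; rewrite ler_pM2l.
have h4 : D * P * (E * S) < D * P * W.
  by move: h3; lra.
by rewrite ltr_pM2l ?mulr_gt0 // in h4.
Qed.

Let agree n (a b : nat -> nat) := forall j, (j < n)%N -> a j = b j.

(* Distinct cylinders of level [k] are further apart than two radii
   [1 / (8 * scale k)], so a cover of [A] by such balls meets at most as many
   cylinders as it has balls. *)
Lemma avoid_small_set (A : set R) (s : R) a n : 0 <= s < alpha ->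
  (upper_minkowski_dim A < s%:E)%E -> admissible a ->
  exists a' n', [/\ admissible a', agree n a a', (n < n')%N &
    forall b, admissible b -> agree n' a' b -> ~ A (expansion b)].
Proof.
move=> sa dimA ha.
have [d d0 hd] := upper_minkowski_dim_lt A s dimA.
have [J hJ] := cylinder_count_growth s n sa.
have [J' hJ'] := exists_nat_ge (d^-1).
pose m := maxn 1 (maxn J J'); pose k := (n + m)%N.
have sc0 : 0 < (scale k)%:R :> R by rewrite ltr0n scale_gt0.
(* The separation [1 / (2 * scale k)] equals [4 * e], more than the diameter [2 * e] of a covering
   ball. *)
pose e : R := (8 * (scale k)%:R)^-1.
have e0 : 0 < e by rewrite invr_gt0 mulr_gt0.
have J'm : (J' <= m)%N by rewrite /m !leq_max leqnn !orbT.
have ed : e < d.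
  rewrite -[d]invrK ltf_pV2 ?posrE ?invr_gt0 ?mulr_gt0 //.
  apply: le_lt_trans (hJ' m J'm) _.
  have mk : m%:R <= (scale k)%:R :> R.
    by rewrite ler_nat; apply: leq_trans (scale_ge k); rewrite leq_addl.
  lra.
have [|T [sT AT]] := hd e; first by rewrite e0.
have Jm : (J <= m)%N by rewrite /m !leq_max leqnn !orbT.
pose W := words (fun i => digit_bound (n + i)) m.
have TW : (size T < size W)%N.
  rewrite -(ltr_nat R); apply: le_lt_trans sT _.
  apply: le_lt_trans (hJ m Jm); rewrite le_eqVlt; apply/orP; left; apply/eqP.
  by rewrite /e -powR_inv1 ?mulr_ge0 // -powRrM mulN1r opprK.
(* Otherwise every word has a cylinder meeting [A] and so is assigned a ball of the cover; by
   separation the assignment is injective, although there are more words than balls. *)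
apply: contrapT => hno.
have hW w : w \in W -> exists x, x \in T /\ exists b, [/\ admissible b,
    agree k (splice a n w) b & `|x - expansion b| <= e].
  move=> wW; apply: contrapT => hx; apply: hno.
  exists (splice a n w), k; split.
  - exact: splice_admissible wW.
  - by move=> j jn; rewrite /splice jn.
  - by rewrite /k -addn1 leq_add2l /m leq_max leqnn.
  - move=> b hb wb /AT[x /= xT]; rewrite closed_ballE //= /closed_ball_ /= => xb.
    by apply: hx; exists x; split => //; exists b.
have hW' w : exists x, w \in W -> x \in T /\ exists b, [/\ admissible b,
    agree k (splice a n w) b & `|x - expansion b| <= e].
  by case: (boolP (w \in W)) => [/hW[x hx]|_]; [exists x|exists 0].
have [f hf] := choice hW'.
have : (size (map f W) <= size T)%N.
  apply: uniq_leq_size.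
    rewrite map_inj_in_uniq ?uniq_words //.
    move=> w w' wW w'W fw.
    have [_ [b [hb wb xb]]] := hf w wW; have [_ [b' [hb' wb' xb']]] := hf w' w'W.
    rewrite -fw in xb'.
    have [sw _] := mem_words _ _ _ wW; have [sw' _] := mem_words _ _ _ w'W.
    have bb' i : (i < k)%N -> b i = b' i.
      move=> ik; apply: contrapT => bi.
      have : (2 * (scale k)%:R)^-1 <= `|expansion b - expansion b' : R|.
        by apply: expansion_separation; [exact: admissible_sparse|exact: admissible_sparse|exists i].
      rewrite [X in `|X|](_ : _ = (f w - expansion b') - (f w - expansion b)); last by ring.
      move=> /le_trans/(_ (ler_normB _ _)).
      have -> : (2 * (scale k)%:R)^-1 = 4 * e by rewrite /e; field; rewrite gt_eqF.
      lra.
    apply: (@eq_from_nth _ 0%N) => [|i]; first by rewrite sw sw'.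
    rewrite sw => im; have nik : (n + i < k)%N by rewrite /k ltn_add2l.
    have := bb' _ nik; rewrite -(wb _ nik) -(wb' _ nik) /splice.
    by rewrite ltnNge leq_addr /= addKn.
  by move=> x /mapP[w /hf[? _] ->].
by rewrite size_map leqNgt TW.
Qed.

(** If all pieces had dimension below a common [s < alpha], [avoid_small_set] could be applied to
    them one after another. The limit of the nested cylinders would be a point of the group in no
    piece. *)
Lemma packing_dim_thin_group_ge : (alpha%:E <= packing_dim (thin_group alpha))%E.
Proof.
apply: le_ereal_inf_tmp => _ [F [BF _] <-].
rewrite leNgt; apply/negP => supF.
have [s [s0 sa hF]] : exists s, [/\ 0 <= s, s < alpha & forall i, (upper_minkowski_dim (F i) < s%:E)%E].
  set M := ereal_sup _ in supF.
  have hM i : (upper_minkowski_dim (F i) <= M)%E by apply: ereal_sup_ubound; exists i.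
  have M0 : (0 <= M)%E := le_trans (upper_minkowski_dim_ge0 _) (hM 0%N).
  case: M hM M0 supF => [r| |] // hM; rewrite lee_fin lte_fin => r0 ra.
  exists ((r + alpha) / 2); split; [lra|lra|move=> i].
  by apply: le_lt_trans (hM i) _; rewrite lte_fin; lra.
have sa' : 0 <= s < alpha by rewrite s0.
pose St := {a : nat -> nat | admissible a}.
have ext (ip : nat * (St * nat)) : exists q : St * nat,
  [/\ agree ip.2.2 (sval ip.2.1) (sval q.1), (ip.2.2 < q.2)%N &
    forall b, admissible b -> agree q.2 (sval q.1) b -> ~ F ip.1 (expansion b)].
  case: ip => i [[a ha] n]; have [a' [n' [ha' aa' nn' h]]] := avoid_small_set _ _ a n sa' (hF i) ha.
  by exists (exist _ a' ha', n').
have [step hstep] := choice ext.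
have adm0 : admissible (fun=> 0%N) by [].
pose st := fix st i := if i is i'.+1 then step (i', st i') else (exist _ (fun=> 0%N) adm0 : St, 0%N).
pose dg i := sval (st i).1; pose lv i := (st i).2.
have dgS i : agree (lv i) (dg i) (dg i.+1) by have [] := hstep (i, st i).
have lvS i : (lv i < lv i.+1)%N by have [] := hstep (i, st i).
have avoid i b : admissible b -> agree (lv i.+1) (dg i.+1) b -> ~ F i (expansion b).
  by have [_ _] := hstep (i, st i); apply.
have lv_ge i : (i <= lv i)%N by elim: i => // i /leq_ltn_trans; apply.
have lv_mono i l : (i <= l)%N -> (lv i <= lv l)%N.
  move=> /subnKC <-; elim: (l - i)%N => [|k IH]; first by rewrite addn0.
  by rewrite addnS (leq_trans IH) // ltnW.
have dg_mono i l : (i <= l)%N -> agree (lv i) (dg i) (dg l).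
  move=> /subnKC <-; elim: (l - i)%N => [|k IH] j ji; first by rewrite addn0.
  rewrite addnS IH //; apply: dgS; apply: leq_trans ji _; apply: lv_mono; exact: leq_addr.
(* Digit [j] is already frozen at stage [j.+1], since [lv j.+1] exceeds [j]; hence [b] lies in every
   chosen cylinder. *)
pose b j := dg j.+1 j.
have hb : admissible b by move=> j; rewrite /b /dg; case: (st j.+1).1.
have : thin_group alpha (expansion b) by exact: admissible_mem.
rewrite BF => -[i _]; apply: avoid => // j ji; rewrite /b.
case: (leqP i j) => ij; first exact: dg_mono.
by apply/esym/(dg_mono j.+1 i.+1); [exact: ltnW|exact: (lv_ge j.+1)].
Qed.

End LowerBound.

Lemma packing_dim_thin_group_le {R : realType} (alpha : R) : 0 <= alpha <= 1 ->
  (packing_dim (thin_group alpha) <= alpha%:E)%E.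
Proof.
move=> a01; apply: (@le_trans _ _
  (ereal_sup (range (fun N => upper_minkowski_dim (thin_piece alpha N))))).
  apply: ereal_inf_lbound; exists (thin_piece alpha) => //; split.
    exact: thin_group_pieces.
  exact: bounded_thin_piece.
by apply: ge_ereal_sup => _ [N _ <-]; exact: upper_minkowski_dim_thin_piece.
Qed.

Theorem mainTheorem8 (R : realType) (alpha : R) (halpha : 0 <= alpha <= 1) :
  exists B : set R,
    [/\ immeasurable B, packing_dim B = alpha%:E & zmod_closed (mem B)].
Proof.
have /andP[_ alpha1] := halpha; exists (thin_group alpha); split.
- exact: immeasurable_thin_group.
- by apply/eqP; rewrite eq_le packing_dim_thin_group_le // packing_dim_thin_group_ge.
- split=> [|x y]; first exact/mem_set/thin_group0.
  by move=> /set_mem Bx /set_mem By; apply/mem_set/thin_groupB.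
Qed.
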